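(* Let $n\ge 2$ and $2\le k\le n-1$ be integers. (i) The tree $T_n^k$ is, up to isomorphism, the unique tree that maximizes the total number of subtrees $F$ among all trees in $\mathscr{T}_n^k$; that is, for every $T\in\mathscr{T}_n^k$ one has $F(T)\le F(T_n^k)$, with equality if and only if $T\cong T_n^k$. Moreover $$F(T_n^k)=\left(\left\lfloor\tfrac{n-1}{k}\right\rfloor+1\right)^i\left(\left\lceil\tfrac{n-1}{k}\right\rceil+1\right)^j+i\binom{\lfloor\frac{n-1}{k}\rfloor+1}{2}+j\binom{\lceil\frac{n-1}{k}\rceil+1}{2},$$ where $i,j$ are nonnegative integers with $i+j=k$ and $n-1\equiv j\pmod{k}$. (ii) The tree $P_{n-k}(\lfloor\frac{k}{2}\rfloor,\lceil\frac{k}{2}\rceil)$ is, up to isomorphism, the unique tree that minimizes $F$ among all trees in $\mathscr{T}_n^k$; that is, for every $T\in\mathscr{T}_n^k$ one has $F(T)\ge F(P_{n-k}(\lfloor\frac{k}{2}\rfloor,\lceil\frac{k}{2}\rceil))$, with equality if and only if $T\cong P_{n-k}(\lfloor\frac{k}{2}\rfloor,\lceil\frac{k}{2}\rceil)$. Moreover $$F\left(P_{n-k}\left(\left\lfloor\tfrac{k}{2}\right\rfloor,\left\lceil\tfrac{k}{2}\right\rceil\right)\right)=\left(2^{\lfloor\frac{k}{2}\rfloor}+2^{\lceil\frac{k}{2}\rceil}\right)(n-k-1)+2^k+k+\binom{n-k-1}{2}.$$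
   Context: All graphs are finite and simple. A subtree of a tree $T$ is a (nonempty) connected induced subgraph of $T$; $F(T)$ denotes the total number of subtrees of $T$ (with at least one vertex; subtrees are counted as distinct subgraphs, not up to isomorphism). A leaf (pendant vertex) is a vertex of degree 1. $\mathscr{T}_n^k$ is the set of all $n$-vertex trees with exactly $k$ leaves ($2\le k\le n-1$). A spider is a tree with at most one vertex of degree more than 2, called the center of the spider (if there is no vertex of degree more than 2, any vertex can be the center). A leg of a spider is a path from the center to a vertex of degree 1; its length is its number of edges. $T_n^k$ is the $n$-vertex spider with $k$ legs whose leg lengths $l_1,\dots,l_k$ (which sum to $n-1$) satisfy $|l_i-l_j|\le 1$ for all $1\le i,j\le k$. $P_m$ is the path on $m$ vertices. For $m\ge2$, $P_m(a,b)$ is the tree obtained by attaching $a$ new pendant vertices to one end vertex of $P_m$ and $b$ new pendant vertices to the other end vertex; for $m=1$, $P_1(a,b)=K_{1,a+b}$, the star with $a+b$ leaves. *)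

(* Defs.v *)
From mathcomp Require Import all_boot.

Set Implicit Arguments.
Unset Strict Implicit.
Unset Printing Implicit Defensive.

Record sgraph := SGraph {
  vertex :> finType;
  adj : rel vertex;
  adj_sym : symmetric adj;
  adj_irr : irreflexive adj }.

Definition iso (G H : sgraph) : Prop :=
  exists2 f : G -> H, bijective f & forall x y, adj (f x) (f y) = adj x y.

Definition degree (G : sgraph) (x : G) : nat := #|[set y | adj x y]|.

Definition leaf (G : sgraph) (x : G) : bool := degree x == 1.

(* The subgraph induced by S is connected; set0 is connected under this
   definition, so nonemptiness is always required separately. *)
Definition connected (G : sgraph) (S : {set G}) : bool :=
  [forall x in S, forall y in S,
     connect [rel u v | [&& u \in S, v \in S & adj u v]] x y].

(* The bound on the size is needed because [:: x; y] is a ucycle as soon as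
   x and y are adjacent. *)
Definition acyclic (G : sgraph) : Prop :=
  forall c : seq G, 2 < size c -> ~~ ucycleb (@adj G) c.

Definition is_tree (G : sgraph) : Prop :=
  [/\ 0 < #|G|, connected [set: G] & acyclic G].

(* An induced subgraph is determined by its vertex set, so the subtrees of a
   tree are counted by their vertex sets. *)
Definition num_subtrees (G : sgraph) : nat :=
  #|[set S : {set G} | (S != set0) && connected S]|.

Definition tree_class (n k : nat) (G : sgraph) : Prop :=
  [/\ is_tree G, #|G| = n & #|[set x : G | leaf x]| = k].

Definition is_spider (G : sgraph) (c : G) : Prop :=
  is_tree G /\ forall v : G, 2 < degree v -> v = c.

(* c :: p is the vertex sequence of the leg, so its length is size p. *)
Definition is_leg (G : sgraph) (c : G) (p : seq G) : bool :=
  [&& p != [::], path (@adj G) c p, uniq (c :: p) & leaf (last c p)].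

(* G is (isomorphic to) T_n^k. The last condition is |l_i - l_j| <= 1, stated
   for all ordered pairs of legs. That the lengths sum to n - 1 is automatic
   from #|G| = n. *)
Definition is_Tnk (n k : nat) (G : sgraph) : Prop :=
  #|G| = n /\
  exists c : G, is_spider c /\
  exists legs : seq (seq G),
    [/\ uniq legs, forall p, (p \in legs) = is_leg c p, size legs = k
      & forall p q, p \in legs -> q \in legs -> size p <= (size q).+1].

(* P_m(a, b): the path is 'I_m, with 'I_a attached to its vertex 0 and 'I_b to
   its vertex m - 1. For m = 1 both ends coincide and this is K_{1,a+b}; it is
   only meaningful for m > 0. *)
Definition Pmab_adj (m a b : nat) : rel ('I_m + ('I_a + 'I_b))%type :=
  fun x y => match x, y with
  | inl i, inl j => (i.+1 == j) || (j.+1 == i)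
  | inl i, inr (inl _) | inr (inl _), inl i => i == 0 :> nat
  | inl i, inr (inr _) | inr (inr _), inl i => i.+1 == m
  | inr _, inr _ => false
  end.

Lemma Pmab_sym m a b : symmetric (@Pmab_adj m a b).
Proof. by case=> [i|[i|i]] [j|[j|j]] //=; rewrite orbC. Qed.

Lemma Pmab_irr m a b : irreflexive (@Pmab_adj m a b).
Proof. by case=> [i|[i|i]] //=; rewrite orbb gtn_eqF. Qed.

Definition Pmab (m a b : nat) : sgraph :=
  SGraph (@Pmab_sym m a b) (@Pmab_irr m a b).

Definition ceil_divn (m d : nat) : nat := (m + d.-1) %/ d.

Lemma ceil_divn_leq m d q : 0 < d -> (ceil_divn m d <= q) = (m <= q * d).
Proof.
by case: d => // d _; rewrite /ceil_divn -ltnS ltn_divLR //= mulSn addSn ltnS addnC leq_add2l.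
Qed.

(* Main.v *)
Require Import Defs.
From mathcomp Require Import all_boot.
From mathcomp Require Import zify.

(** Both parts are local-improvement arguments. Write a tree as a base [R] and a
branch [A] joined by an edge between a vertex [r] of [R] and a vertex [a] of
[A]. If [F] counts all subtrees and [f] those through a given vertex, then
[F(tree) = F(R) + F(A) + f(R, r) * f(A, a)]. Hence moving the branch [A] from
[r] to another vertex [s] of [R] changes the number of subtrees by
[(f(R, s) - f(R, r)) * f(A, a)]. The move keeps the number of leaves when [r]
has at least two neighbors left and [s] is not a leaf.

Maximum. If a tree has two branching vertices, some branch can be moved one edge
along the path between them so as to increase [F] ([branching_improves]). Every
edge has a heavier side, the one with more subtrees through its end of the edge,
and a branch gains by crossing the edge towards the heavier side. If the first
edge of the path is heavier on the far side, a branch of the first vertex should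
cross it. Otherwise the near side stays at least as heavy along the path, and a
branch of the next branching vertex should be moved one edge back. So a maximal
tree is a spider. With at least three legs, moving a vertex from a long leg to a
short one shows that the legs are balanced ([unbalanced_improves]); with two
legs the tree is a path. The number of subtrees of a spider is the product of the
[l + 1] over the leg lengths [l] (subtrees through the center) plus the number of
paths inside the legs.

Minimum. If a vertex [r] has two neighbors [x], [y] that are not leaves and a
third branch, that branch can be moved to [x] or to [y] so as to decrease [F]
([move_away]): in the remaining tree, if at least as many subtrees passed
through [x] as through [r], and also through [y], then the branch at [x] would be
heavier than the branch at [y] and conversely. A tree without such a vertex is a
path with stars at its ends, and its number of subtrees depends on the two
numbers of leaves [a] and [b] through [2 ^ a + 2 ^ b] only, which is smallest for
a balanced distribution ([balanced_powers]).

The arguments are carried out on terms [rtree], which build rooted trees from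
single vertices by joining roots. On terms, numbers of vertices, leaves and
subtrees are computed by recursion, and moving a branch is rewriting a term;
[tree_realize] shows that every tree, with any of its vertices as root, is the
realization of a term. *)

Set Implicit Arguments.
Unset Strict Implicit.
Unset Printing Implicit Defensive.

(** * Isomorphism invariance *)

Definition embedding (G H : sgraph) (f : G -> H) :=
  injective f /\ forall u v, adj (f u) (f v) = adj u v.

Lemma iso_refl G : iso G G.
Proof. by exists id => //; exists id. Qed.

Lemma iso_sym G H : iso G H -> iso H G.
Proof.
case=> f [g fK gK] f_adj; exists g; first by exists f.
by move=> x y; rewrite -f_adj !gK.
Qed.

Lemma iso_trans G H K : iso G H -> iso H K -> iso G K.
Proof.
case=> f f_bij f_adj [g g_bij g_adj]; exists (g \o f); first exact: bij_comp.
by move=> x y /=; rewrite g_adj f_adj.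
Qed.

Lemma connect_hom (V W : finType) (e : rel V) (e' : rel W) (g : V -> W) x y :
  (forall u v, e u v -> connect e' (g u) (g v)) ->
  connect e x y -> connect e' (g x) (g y).
Proof.
move=> g_hom /connectP[p]; elim: p x => [|z p IHp] x /=; first by move=> _ ->.
by case/andP=> /g_hom xz zp /(IHp _ zp); apply: connect_trans.
Qed.

Lemma connectedP (G : sgraph) (S : {set G}) :
  reflect {in S &, forall x y,
            connect [rel u v | [&& u \in S, v \in S & adj u v]] x y}
          (connected S).
Proof.
apply: (iffP forall_inP) => [cS x y xS yS | cS x xS].
  by move/forall_inP: (cS x xS); apply.
by apply/forall_inP => y; apply: cS.
Qed.

Lemma connected0 (G : sgraph) : connected (@set0 G).
Proof. by apply/connectedP => x y; rewrite inE. Qed.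

Lemma connected_imset (G H : sgraph) (f : G -> H) (S : {set G}) :
  {homo f : x y / adj x y} -> connected S -> connected (f @: S).
Proof.
move=> f_adj /connectedP cS; apply/connectedP => _ _ /imsetP[x xS ->] /imsetP[y yS ->].
apply: connect_hom (cS x y xS yS) => u v /and3P[uS vS uv].
by apply: connect1; rewrite /= !imset_f // f_adj.
Qed.

Lemma iso_degree (G H : sgraph) (f : G -> H) :
  bijective f -> (forall x y, adj (f x) (f y) = adj x y) ->
  forall x, degree (f x) = degree x.
Proof.
move=> f_bij f_adj x; rewrite /degree -(card_imset _ (bij_inj f_bij)).
congr #|pred_of_set _|; apply/setP => z; case: f_bij => g fK gK.
rewrite -[z]gK mem_imset ?inE ?f_adj //; exact: can_inj fK.
Qed.

Lemma iso_num_subtrees G H : iso G H -> num_subtrees G = num_subtrees H.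
Proof.
suff le G' H' : iso G' H' -> num_subtrees G' <= num_subtrees H'.
  by move=> isoGH; apply/eqP; rewrite eqn_leq !le //; apply: iso_sym.
case=> f /bij_inj f_inj f_adj; rewrite /num_subtrees.
rewrite -(card_imset _ (imset_inj f_inj)); apply/subset_leq_card/subsetP => _ /imsetP[S + ->].
rewrite !inE => /andP[S0 cS]; rewrite connected_imset ?andbT //; last first.
  by move=> x y; rewrite f_adj.
by apply: contraNneq S0 => /eqP; rewrite imset_eq0.
Qed.

Definition num_leaves (G : sgraph) := #|[set x : G | leaf x]|.

Lemma iso_card G H : iso G H -> #|G| = #|H|.
Proof. by case=> f /bij_eq_card. Qed.

Lemma iso_num_leaves G H : iso G H -> num_leaves G = num_leaves H.
Proof.
case=> f f_bij f_adj; rewrite /num_leaves -(card_imset _ (bij_inj f_bij)).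
congr #|pred_of_set _|; apply/setP => z.
have degE := iso_degree f_bij f_adj; case: f_bij => g fK gK.
rewrite -[z]gK mem_imset ?inE /leaf ?degE //; exact: can_inj fK.
Qed.

Lemma map_ucycleb (G H : sgraph) (f : G -> H) c :
  embedding f -> ucycleb (@adj H) (map f c) = ucycleb (@adj G) c.
Proof.
move=> [f_inj f_adj]; rewrite /ucycleb map_inj_uniq //; congr (_ && _).
case: c => //= x c; rewrite -map_rcons path_map; apply: eq_path => u v; exact: f_adj.
Qed.

Lemma iso_is_tree G H : iso G H -> is_tree G -> is_tree H.
Proof.
move=> isoGH [G0 cG aG]; split; first by rewrite -(iso_card isoGH).
  case: isoGH => f [g fK gK] f_adj.
  have <- : f @: [set: G] = [set: H].
    by apply/setP => z; rewrite -[z]gK !inE mem_imset ?inE //; apply: can_inj fK.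
  by apply: connected_imset => // x y; rewrite f_adj.
case/iso_sym: isoGH => g /bij_inj g_inj g_adj c c2.
by rewrite -(map_ucycleb c (conj g_inj g_adj)); apply: aG; rewrite size_map.
Qed.

(** * Rooted graphs and grafts *)

Record rooted := Rooted { rooted_graph :> sgraph; rootv : rooted_graph }.

Definition riso (G H : rooted) : Prop :=
  exists f : G -> H,
    [/\ bijective f, forall x y, adj (f x) (f y) = adj x y & f (rootv G) = rootv H].

Lemma riso_iso G H : riso G H -> iso G H.
Proof. by case=> f [f_bij f_adj _]; exists f. Qed.

Lemma riso_refl G : riso G G.
Proof. by exists id; split=> //; exists id. Qed.

Lemma riso_trans H G K : riso G H -> riso H K -> riso G K.
Proof.
case=> f [f_bij f_adj f_root] [g [g_bij g_adj g_root]]; exists (g \o f); split.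
- exact: bij_comp.
- by move=> x y /=; rewrite g_adj f_adj.
- by rewrite /= f_root.
Qed.

Lemma riso_degree G H : riso G H -> degree (rootv G) = degree (rootv H).
Proof. by case=> f [f_bij f_adj <-]; rewrite (iso_degree f_bij f_adj). Qed.

Definition graft_adj (R A : rooted) : rel (R + A)%type :=
  fun u v => match u, v with
  | inl x, inl y => adj x y
  | inr x, inr y => adj x y
  | inl x, inr y | inr y, inl x => (x == rootv R) && (y == rootv A)
  end.

Lemma graft_sym R A : symmetric (@graft_adj R A).
Proof. by case=> x [] y //=; rewrite adj_sym. Qed.

Lemma graft_irr R A : irreflexive (@graft_adj R A).
Proof. by case=> x /=; rewrite adj_irr. Qed.

Definition graft (R A : rooted) : rooted :=
  @Rooted (SGraph (@graft_sym R A) (@graft_irr R A)) (inl (rootv R)).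

Definition dot : rooted :=
  @Rooted (@SGraph unit (fun _ _ => false) (fun _ _ => erefl) (fun _ => erefl)) tt.

Definition sum_map (A B C D : Type) (f : A -> B) (g : C -> D) (u : A + C) : B + D :=
  match u with inl x => inl (f x) | inr y => inr (g y) end.

Lemma graft_riso R R' A A' :
  riso R R' -> riso A A' -> riso (graft R A) (graft R' A').
Proof.
case=> f [[f' fK f'K] f_adj f_root] [g [[g' gK g'K] g_adj g_root]].
exists (sum_map f g); split=> [|[x|x] [y|y]|] //=; last by rewrite f_root.
- exists (sum_map f' g') => [] [x|x] /=; congr (_ _); by [].
- by rewrite -f_root -g_root !(can_eq fK, can_eq gK).
- by rewrite -f_root -g_root !(can_eq fK, can_eq gK).
Qed.

Lemma graft_swap R A B : riso (graft (graft R A) B) (graft (graft R B) A).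
Proof.
pose sw S T (u : (R + S) + T) : (R + T) + S :=
  match u with inl (inl x) => inl (inl x) | inl (inr y) => inr y | inr z => inl (inr z) end.
exists (sw A B); split=> //.
  by exists (sw B A) => [] [[]|].
by case=> [[x|x]|x] [[y|y]|y].
Qed.

Lemma graft_flip R A : iso (graft R A) (graft A R).
Proof.
pose fl S T (u : S + T) : T + S := match u with inl x => inr x | inr y => inl y end.
exists (fl R A); first by exists (fl A R) => [] [].
by case=> x [] y //=; rewrite andbC.
Qed.

Lemma card_graft R A : #|graft R A| = #|R| + #|A|.
Proof. exact: card_sum. Qed.

Lemma sum_graft (R A : rooted) (w : graft R A -> nat) :
  \sum_u w u = \sum_x w (inl x) + \sum_y w (inr y).
Proof. exact: big_sumType. Qed.

Lemma degreeE (G : sgraph) (x : G) : degree x = \sum_y adj x y.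
Proof. by rewrite /degree -sum1dep_card big_mkcond. Qed.

Lemma degree_graft_l (R A : rooted) (x : R) :
  degree (inl x : graft R A) = degree x + (x == rootv R).
Proof.
rewrite !degreeE sum_graft /=; congr (_ + _).
rewrite (bigD1 (rootv A)) //= eqxx andbT big1 ?addn0 // => y /negPf ->.
by rewrite andbF.
Qed.

Lemma degree_graft_r (R A : rooted) (y : A) :
  degree (inr y : graft R A) = degree y + (y == rootv A).
Proof.
rewrite !degreeE sum_graft /= addnC; congr (_ + _).
by rewrite (bigD1 (rootv R)) //= eqxx big1 ?addn0 // => x /negPf ->.
Qed.

Lemma degree_dot : degree (rootv dot) = 0.
Proof. by rewrite degreeE big1. Qed.

(** * Subtrees of a graft *)

Definition graft_set (R A : rooted) (X : {set R}) (Y : {set A}) : {set graft R A} :=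
  [set u | match u with inl x => x \in X | inr y => y \in Y end].

Lemma graft_set_bij (R A : rooted) :
  bijective (fun p : {set R} * {set A} => graft_set p.1 p.2).
Proof.
exists (fun S : {set graft R A} => ([set x | inl x \in S], [set y | inr y \in S])).
  by case=> X Y; congr pair; apply/setP => z; rewrite !inE.
by move=> S; apply/setP => -[x|y]; rewrite !inE.
Qed.

Lemma graft_set_eq0 (R A : rooted) (X : {set R}) (Y : {set A}) :
  (graft_set X Y == set0) = (X == set0) && (Y == set0).
Proof.
apply/eqP/andP => [S0 | [/eqP-> /eqP->]]; last by apply/setP => -[x|y]; rewrite !inE.
split; apply/eqP/setP => z.
  by have:= in_set0 (inl z : graft R A); rewrite -S0 !inE.
by have:= in_set0 (inr z : graft R A); rewrite -S0 !inE.
Qed.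

(** The only edge between the two parts joins the roots, so a connected set
that meets both parts contains both roots. *)
Lemma graft_connected_roots (R A : rooted) (X : {set R}) (Y : {set A}) x y :
  connected (graft_set X Y) -> x \in X -> y \in Y ->
  (rootv R \in X) && (rootv A \in Y).
Proof.
move=> /connectedP cS xX yY; apply: contraT => not_roots.
have /= := cS (inl x) (inr y); rewrite !inE => /(_ xX yY) xy.
pose inL : pred (graft R A) := fun u => if u is inl _ then true else false.
have clL : closed [rel u v : graft R A |
    [&& u \in graft_set X Y, v \in graft_set X Y & adj u v]] inL.
  move=> [u|u] [v|v] //=; rewrite !inE => /and3P[uS vS /andP[/eqP uE /eqP vE]].
    by rewrite -uE -vE uS vS in not_roots.
  by rewrite -uE -vE uS vS in not_roots.
by have := closed_connect clL xy.
Qed.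

Lemma connected_graft_set (R A : rooted) (X : {set R}) (Y : {set A}) :
  connected (graft_set X Y) =
    [&& connected X, connected Y &
     [|| X == set0, Y == set0 | (rootv R \in X) && (rootv A \in Y)]].
Proof.
apply/idP/idP => [cS|].
  have roots x y := graft_connected_roots cS (x := x) (y := y).
  apply/and3P; split; last first.
  - have [-> //|[x xX]] := set_0Vmem X; first by rewrite eqxx.
    have [->|[y yY]] := set_0Vmem Y; first by rewrite eqxx orbT.
    by rewrite (roots x y) ?orbT.
  - apply/connectedP => x y xY yY.
    pose g (u : graft R A) := if u is inr z then z else rootv A.
    move/connectedP/(_ (inr x) (inr y)): cS; rewrite !inE => /(_ xY yY).
    apply: (connect_hom (g := g)) => [[u|u] [v|v]]; rewrite /= !inE => /and3P[uS vS uv] //.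
    + by case/andP: uv => _ /eqP->.
    + by case/andP: uv => _ /eqP->.
    + by apply: connect1; rewrite /= uS vS.
  - apply/connectedP => x y xX yX.
    pose g (u : graft R A) := if u is inl z then z else rootv R.
    move/connectedP/(_ (inl x) (inl y)): cS; rewrite !inE => /(_ xX yX).
    apply: (connect_hom (g := g)) => [[u|u] [v|v]]; rewrite /= !inE => /and3P[uS vS uv] //.
    + by apply: connect1; rewrite /= uS vS.
    + by case/andP: uv => /eqP->.
    + by case/andP: uv => /eqP->.
case/and3P=> /connectedP cX /connectedP cY link; apply/connectedP.
pose e := [rel u v : graft R A |
  [&& u \in graft_set X Y, v \in graft_set X Y & adj u v]].
have XX x y : x \in X -> y \in X -> connect e (inl x) (inl y).
  move=> xX yX; apply: connect_hom (cX x y xX yX) => u v /and3P[uX vX uv].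
  by apply: connect1; rewrite /= !inE uX vX.
have YY x y : x \in Y -> y \in Y -> connect e (inr x) (inr y).
  move=> xX yX; apply: connect_hom (cY x y xX yX) => u v /and3P[uX vX uv].
  by apply: connect1; rewrite /= !inE uX vX.
have roots x y : x \in X -> y \in Y -> (rootv R \in X) && (rootv A \in Y).
  by move=> xX yY; case/or3P: link => // /eqP S0; rewrite S0 inE in xX yY.
case=> x [] y; rewrite !inE => xS yS; [exact: XX | | | exact: YY].
- have /andP[rX rY] := roots _ _ xS yS.
  apply: connect_trans (XX _ _ xS rX) (connect_trans _ (YY _ _ rY yS)).
  by apply: connect1; rewrite /= !inE rX rY !eqxx.
- have /andP[rX rY] := roots _ _ yS xS.
  apply: connect_trans (YY _ _ xS rY) (connect_trans _ (XX _ _ rX yS)).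
  by apply: connect1; rewrite /= !inE rX rY !eqxx.
Qed.

Definition num_root_subtrees (G : rooted) :=
  #|[set S : {set G} | (rootv G \in S) && connected S]|.

Lemma num_subtreesE (G : sgraph) :
  num_subtrees G = \sum_(S : {set G}) ((S != set0) && connected S).
Proof. by rewrite /num_subtrees -sum1dep_card big_mkcond. Qed.

Lemma num_root_subtreesE (G : rooted) :
  num_root_subtrees G = \sum_(S : {set G}) ((rootv G \in S) && connected S).
Proof. by rewrite /num_root_subtrees -sum1dep_card big_mkcond. Qed.

Lemma sum_graft_set (R A : rooted) (w : {set graft R A} -> nat) :
  \sum_S w S = \sum_(X : {set R}) \sum_(Y : {set A}) w (graft_set X Y).
Proof.
by rewrite pair_bigA (reindex _ (onW_bij _ (graft_set_bij R A))).
Qed.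

Lemma sum_set0 (T : finType) : \sum_(S : {set T}) (S == set0) = 1.
Proof. by rewrite (bigD1 set0) //= eqxx big1 // => S /negPf->. Qed.

(** A subtree through the root of the base can be continued by any subtree
through the root of the branch, or not enter the branch. *)
Lemma root_subtrees_graft R A :
  num_root_subtrees (graft R A) = num_root_subtrees R * (num_root_subtrees A).+1.
Proof.
rewrite !num_root_subtreesE sum_graft_set -addn1 -(sum_set0 A) -big_split big_distrl /=.
apply: eq_bigr => X _; rewrite big_distrr /=; apply: eq_bigr => Y _.
rewrite connected_graft_set inE.
have [-> |Y0] := eqVneq Y set0; first by rewrite inE connected0 /= orbT andbT muln1.
have [->|X0] := eqVneq X set0; first by rewrite inE.
by case: (rootv R \in X); case: (rootv A \in Y); case: (connected X); case: (connected Y).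
Qed.

(** A subtree of a graft lies in the base, or in the branch, or consists of a
subtree of each of them through its root. *)
Lemma num_subtrees_graft R A :
  num_subtrees (graft R A) =
    num_subtrees R + num_subtrees A + num_root_subtrees R * num_root_subtrees A.
Proof.
rewrite !num_subtreesE !num_root_subtreesE sum_graft_set.
rewrite -[X in X + _ + _]muln1 -[X in _ + X + _]mul1n -{1}(sum_set0 A) -(sum_set0 R).
rewrite !big_distrlr -!big_split /=; apply: eq_bigr => X _.
rewrite -!big_split /=; apply: eq_bigr => Y _.
rewrite connected_graft_set graft_set_eq0.
have [-> |Y0] := eqVneq Y set0; have [->|X0] := eqVneq X set0; rewrite ?inE ?connected0 //=.
- by rewrite !andbT; case: (connected X); rewrite /= ?muln0.
- by rewrite !andbT; case: (connected Y).
- by case: (rootv R \in X); case: (rootv A \in Y); case: (connected X); case: (connected Y).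
Qed.

Lemma root_subtrees_dot : num_root_subtrees dot = 1.
Proof.
rewrite -(cards1 [set: dot]); apply: eq_card => S; rewrite !inE.
apply/andP/eqP => [[tS _]|->]; first by apply/setP => -[]; rewrite tS inE.
by rewrite inE; split=> //; apply/connectedP => -[] [].
Qed.

Lemma num_subtrees_dot : num_subtrees dot = 1.
Proof.
rewrite -root_subtrees_dot; apply: eq_card => S; rewrite !inE.
have [tS|tS] := boolP (rootv dot \in S); first by case: eqP tS => // ->; rewrite inE.
by have [->|[[]]] := set_0Vmem S; rewrite ?eqxx // (negPf tS).
Qed.

(** * Grafts of trees are trees *)

Lemma connected_graft (R A : rooted) :
  connected [set: R] -> connected [set: A] -> connected [set: graft R A].
Proof.
move=> cR cA; have -> : [set: graft R A] = graft_set setT setT.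
  by apply/setP => -[x|y]; rewrite !inE.
by rewrite connected_graft_set cR cA !inE !orbT.
Qed.

Lemma connected_dot : connected [set: dot].
Proof. by apply/connectedP => -[] []. Qed.

Lemma acyclic_dot : acyclic dot.
Proof. by case=> [|[] [|[] c]]. Qed.


(** A walk can change sides only along the new edge, that is, by visiting both
roots. *)
Lemma path_graft_side (R A : rooted) (u : graft R A) p :
  path (@adj (graft R A)) u p ->
  ~~ ((inl (rootv R) \in u :: p) && (inr (rootv A) \in u :: p)) ->
  (exists q, u :: p = map inl q) \/ (exists q, u :: p = map inr q).
Proof.
elim: p u => [|v p IHp] u.
  by case: u => x _ _; [left | right]; exists [:: x].
rewrite [path _ _ _]/= => /andP[uv /IHp vp] one_root.
case: vp => [|[q vpE]|[q vpE]].
- by apply: contra one_root => /andP[rv av]; rewrite !(in_cons u) rv av !orbT.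
- case: u uv one_root => [x|y] uv one_root; first by left; exists (x :: q); rewrite vpE.
  by case: q vpE => // z q [-> _] in uv one_root *; case/andP: uv one_root => /eqP-> /eqP->;
    rewrite !inE !eqxx ?orbT.
- case: u uv one_root => [x|y] uv one_root; last by right; exists (y :: q); rewrite vpE.
  by case: q vpE => // z q [-> _] in uv one_root *; case/andP: uv one_root => /eqP-> /eqP->;
    rewrite !inE !eqxx ?orbT.
Qed.

(** A cycle that meets both parts would use the edge between the roots in both
directions, hence have length two. *)
Lemma acyclic_graft (R A : rooted) : acyclic R -> acyclic A -> acyclic (graft R A).
Proof.
move=> aR aA c c2; apply/negP => cc.
have [/andP[rc ac]|one_root] := boolP ((inl (rootv R) \in c) && (inr (rootv A) \in c));
    last first.
  have : (exists q, c = map inl q) \/ (exists q, c = map inr q).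
    case: c cc one_root {c2} => [|u c]; first by left; exists [::].
    by rewrite /ucycleb /= rcons_path => /andP[/andP[cp _] _]; apply: path_graft_side.
  case=> -[q qE]; move: c2 cc; rewrite qE size_map map_ucycleb; try by [split=> // u v []].
    by move=> q2; apply/negP/aR.
  by move=> q2; apply/negP/aA.
(* Start the cycle at the root of the base. *)
have [i s rotE] := rot_to rc.
move: c2 cc ac; rewrite -(size_rot i) -(mem_rot i) /ucycleb -(rot_uniq i) -(rot_cycle i) rotE /=.
rewrite rcons_path inE /= => c2 /andP[/andP[sp sl] /andP[rs su]] as_.
case/splitPr: as_ c2 sp sl rs su {rotE} => s1 s2.
rewrite cat_path last_cat mem_cat inE !negb_or cat_uniq /=.
move=> c2 /and3P[s1p l1 s2p] l2 /andP[rs1 rs2] /and3P[_ /norP[as1 _] /andP[as2 _]].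
have s1E : s1 = [::].
  have [|[q qE]|[[|? ?]]] := path_graft_side s1p; rewrite ?inE //=; first by rewrite (negPf as1) andbF.
  move: l1; case/lastP: s1 as1 rs1 qE {c2 s1p} => // s1 [x|y] as1 rs1 qE; rewrite last_rcons.
    by case/andP=> /eqP xr _; rewrite xr mem_rcons inE eqxx in rs1.
  have : inr y \in map inl q :> bool by rewrite -qE inE mem_rcons inE eqxx orbT.
  by case/mapP.
have s2E : s2 = [::].
  have [|[[|? ?]]|[q qE]] := path_graft_side s2p; rewrite ?inE //=; first by rewrite (negPf rs2).
  move: l2; case/lastP: s2 as2 rs2 qE {c2 s2p} => // s2 [x|y] as2 rs2 qE; rewrite last_rcons.
    have : inl x \in map inr q :> bool by rewrite -qE inE mem_rcons inE eqxx orbT.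
    by case/mapP.
  by case/andP=> _ /eqP xr; rewrite xr mem_rcons inE eqxx in as2.
by rewrite s1E s2E in c2.
Qed.

(** * Terms for rooted trees *)

(** Every rooted tree arises from the one-vertex tree by grafts; the branches
of the root are the second arguments along the leftmost chain of grafts. *)
Inductive rtree := Dot | Graft of rtree & rtree.

Fixpoint realize (t : rtree) : rooted :=
  if t is Graft R A then graft (realize R) (realize A) else dot.

Fixpoint nverts (t : rtree) : nat :=
  if t is Graft R A then nverts R + nverts A else 1.

Fixpoint rdeg (t : rtree) : nat := if t is Graft R _ then (rdeg R).+1 else 0.

(** The root is set aside because it stops being a leaf, or becomes one, when
the tree is grafted. *)
Fixpoint outer_leaves (t : rtree) : nat :=
  if t is Graft R A then outer_leaves R + outer_leaves A + (rdeg A == 0) else 0.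

Definition leaves (t : rtree) : nat := outer_leaves t + (rdeg t == 1).

Fixpoint rsub (t : rtree) : nat :=
  if t is Graft R A then rsub R * (rsub A).+1 else 1.

Fixpoint nsub (t : rtree) : nat :=
  if t is Graft R A then nsub R + nsub A + rsub R * rsub A else 1.

(** The recursive functions on terms compute the parameters of the realized
graphs, so that extremal arguments become arithmetic. *)
Lemma realize_nverts t : #|realize t| = nverts t.
Proof. by elim: t => [|R IHR A IHA]; rewrite ?card_unit //= card_graft IHR IHA. Qed.

Lemma realize_rdeg t : degree (rootv (realize t)) = rdeg t.
Proof.
by elim: t => [|R IHR A _]; rewrite ?degree_dot //= degree_graft_l eqxx IHR addn1.
Qed.

Lemma num_leavesE (G : sgraph) : num_leaves G = \sum_(x : G) leaf x.
Proof. by rewrite /num_leaves -sum1dep_card big_mkcond. Qed.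

Lemma realize_leaves t : num_leaves (realize t) = leaves t.
Proof.
have outerE s : \sum_(x : realize s) ((x != rootv (realize s)) && leaf x) = outer_leaves s.
  elim: s => [|R IHR A IHA]; first by rewrite big1 // => -[].
  rewrite [LHS]sum_graft /= -IHR -IHA -addnA; congr (_ + _).
    by apply: eq_bigr => x _; rewrite /leaf degree_graft_l (inj_eq inl_inj); case: eqP; rewrite ?addn0.
  rewrite -(realize_rdeg A) [LHS](bigD1 (rootv (realize A))) //.
  rewrite [in RHS](bigD1 (rootv (realize A))) //= eqxx add0n addnC; congr (_ + _).
    by apply: eq_bigr => y /negPf yr; rewrite /leaf degree_graft_r yr addn0.
  by rewrite /leaf degree_graft_r eqxx addn1 eqSS.
rewrite num_leavesE /leaves -outerE -realize_rdeg.
rewrite (bigD1 (rootv (realize t))) //= addnC [in RHS](bigD1 (rootv (realize t))) //= eqxx add0n.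
by congr (_ + _); apply: eq_bigr => x ->.
Qed.

Lemma realize_rsub t : num_root_subtrees (realize t) = rsub t.
Proof.
by elim: t => [|R IHR A IHA]; rewrite ?root_subtrees_dot //= root_subtrees_graft IHR IHA.
Qed.

Lemma realize_nsub t : num_subtrees (realize t) = nsub t.
Proof.
elim: t => [|R IHR A IHA]; rewrite ?num_subtrees_dot //= num_subtrees_graft.
by rewrite IHR IHA !realize_rsub.
Qed.

Lemma realize_connected t : connected [set: realize t].
Proof. elim: t => [|R IHR A IHA]; [exact: connected_dot | exact: connected_graft]. Qed.

Lemma realize_tree t : is_tree (realize t).
Proof.
split; last 1 first.
- elim: t => [|R IHR A IHA]; [exact: acyclic_dot | exact: acyclic_graft].
- by apply/card_gt0P; exists (rootv (realize t)).
- exact: realize_connected.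
Qed.

(** * Every tree is realized by a term *)

(** The new vertex is hung below the root of the part that contains its
neighbor; the recursion ends at a one-vertex part. *)
Lemma embedding_attach (G : sgraph) t (h : realize t -> G) p x :
  embedding h -> (forall u, h u != x) -> (forall u, adj (h u) x = (u == p)) ->
  exists t' (h' : realize t' -> G),
    [/\ embedding h', h' (rootv (realize t')) = h (rootv (realize t)),
        nverts t' = (nverts t).+1 & forall z, h' z = x \/ exists w, h' z = h w].
Proof.
elim: t h p => [|R IHR A IHA] h p [h_inj h_adj] xNh x_adj.
  pose h' (z : realize (Graft Dot Dot)) := if z is inl _ then h tt else x.
  have hx := x_adj tt; case: p hx {x_adj} => hx.
  exists (Graft Dot Dot), h'; split=> //; last by case=> -[]; [right; exists tt | left].
  split=> -[[]|[]] [[]|[]] //=.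
  - by move=> hxE; have:= xNh tt; rewrite hxE eqxx.
  - by move=> hxE; have:= xNh tt; rewrite hxE eqxx.
  - by rewrite adj_sym hx.
  - by rewrite adj_irr.
pose r : realize R := rootv _; pose a : realize A := rootv _.
case: p x_adj => p x_adj.
- have hl_adj u v : adj (h (inl u)) (h (inl v)) = adj u v by rewrite h_adj.
  have [|||R' [g [[g_inj g_adj] g_root oR' g_im]]] := IHR (h \o inl) p.
  + by split=> // u v /h_inj[].
  + by move=> u; apply: xNh.
  + by move=> u; apply: x_adj.
  have gNh z y : g z <> h (inr y).
    by case: (g_im z) => [->|[w ->] /h_inj//] xE; have:= xNh (inr y); rewrite xE eqxx.
  have gh_adj z y : adj (g z) (h (inr y)) = (z == rootv _) && (y == a).
    rewrite -(inj_eq g_inj) g_root /=; case: (g_im z) => [->|[w ->]] /=.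
      by rewrite adj_sym x_adj [x == _]eq_sym (negPf (xNh _)).
    by rewrite h_adj (inj_eq h_inj).
  exists (Graft R' A), (fun z => match z with inl u => g u | inr y => h (inr y) end).
  split=> //=; last first.
  + case=> z; last by right; exists (inr z).
    by case: (g_im z) => [->|[w ->]]; [left | right; exists (inl w)].
  + by rewrite oR'.
  split=> -[u|u] [v|v] /=.
  + by move/g_inj->.
  + by move/gNh.
  + by move/esym/gNh.
  + by move/h_inj=> [->].
  + by rewrite g_adj.
  + by rewrite gh_adj.
  + by rewrite adj_sym gh_adj.
  + by rewrite h_adj.
- have [|||A' [g [[g_inj g_adj] g_root oA' g_im]]] := IHA (h \o inr) p.
  + by split=> [u v /h_inj[]|u v] //=; rewrite h_adj.
  + by move=> u; apply: xNh.
  + by move=> u; apply: x_adj.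
  have gNh z y : g z <> h (inl y).
    by case: (g_im z) => [->|[w ->] /h_inj//] xE; have:= xNh (inl y); rewrite xE eqxx.
  have gh_adj z y : adj (h (inl y)) (g z) = (y == r) && (z == rootv _).
    rewrite -(inj_eq g_inj) g_root /=; case: (g_im z) => [->|[w ->]] /=.
      by rewrite x_adj [x == _]eq_sym (negPf (xNh _)) andbF.
    by rewrite h_adj (inj_eq h_inj).
  exists (Graft R A'), (fun z => match z with inr u => g u | inl y => h (inl y) end).
  split=> //=; last first.
  + case=> z; first by right; exists (inl z).
    by case: (g_im z) => [->|[w ->]]; [left | right; exists (inr w)].
  + by rewrite oA' addnS.
  split=> -[u|u] [v|v] /=.
  + by move/h_inj=> [->].
  + by move/esym/gNh.
  + by move/gNh.
  + by move/g_inj->.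
  + by rewrite h_adj.
  + by rewrite gh_adj.
  + by rewrite adj_sym gh_adj.
  + by rewrite g_adj.
Qed.

(** Two neighbors of [x] in a connected set avoiding [x] would close a cycle
through [x]. *)
Lemma embedding_unique_neighbor (G : sgraph) t (h : realize t -> G) p q x :
  acyclic G -> embedding h -> (forall u, h u != x) ->
  adj (h p) x -> adj (h q) x -> p = q.
Proof.
move=> aG [h_inj h_adj] xNh px qx; apply/eqP; apply: contraT => pNq.
have /connectP[s sp qE] : connect (@adj (realize t)) p q.
  have/connectedP/(_ p q) := realize_connected t; rewrite !inE => /(_ isT isT).
  by apply: connect_sub => u v /and3P[_ _ uv]; apply: connect1.
case/shortenP: sp qE => s' s'p s'u _ qE.
have s'0 : 0 < size s' by case: s' qE {s'p s'u} => //= qp; rewrite qp eqxx in pNq.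
have := aG (x :: map h (p :: s')); rewrite /= size_map 2!ltnS => /(_ s'0) /negP[].
rewrite -(map_cons h); apply/andP; split.
  rewrite /= rcons_path adj_sym px path_map last_map -qE qx andbT.
  by rewrite (eq_path (e' := @adj (realize t))).
rewrite cons_uniq map_inj_uniq // s'u andbT.
by apply/mapP => -[z _ xE]; have := xNh z; rewrite xE eqxx.
Qed.

(** A partial copy that is not the whole tree misses a neighbor of one of its
vertices, by connectedness, and that neighbor can be attached. *)
Lemma tree_realize (G : sgraph) (r : G) :
  is_tree G -> exists t, riso (realize t) (Rooted r).
Proof.
case=> _ /connectedP cG aG.
suff grow m : m <= #|G|.-1 -> exists t (h : realize t -> G),
    [/\ embedding h, h (rootv (realize t)) = r & nverts t = m.+1].
  have G0 : 0 < #|G| by apply/card_gt0P; exists r.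
  have [t [h [[h_inj h_adj] h_root ot]]] := grow _ (leqnn _).
  exists t, h; split=> //; apply: inj_card_bij => //.
  by rewrite realize_nverts ot prednK.
elim: m => [|m IHm] lemG.
  exists Dot, (fun _ => r); split=> //; split=> [[] []|[] []] //; exact: adj_irr.
have [t [h [[h_inj h_adj] h_root ot]]] := IHm (ltnW lemG).
have [y yNh] : exists y, y \notin codom h.
  apply/existsP; apply: contraT => /existsPn all_im.
  have : #|G| <= nverts t.
    rewrite -realize_nverts -(card_codom h_inj) -cardsT; apply/subset_leq_card/subsetP => z _.
    by have := all_im z; rewrite negbK.
  by rewrite ot => ?; lia.
have [p [x [xNh px]]] : exists p x, x \notin codom h /\ adj (h p) x.
  have := cG r y; rewrite !inE => /(_ isT isT) ry.
  have : r \in codom h by rewrite -h_root codom_f.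
  case/connectP: ry => s; elim: s (r) => [|z s IHs] r' /=.
    by move=> _ yE rh; rewrite yE rh in yNh.
  case/andP=> /and3P[_ _ rz] /IHs sP yE rh; have [zh|zNh] := boolP (z \in codom h).
    exact: sP.
  by case/codomP: rh rz => p -> pz; exists p, z.
have xNh' u : h u != x by apply: contra xNh => /eqP<-; apply: codom_f.
have [||t' [h' [emb' h'_root ot' _]]] := @embedding_attach G t h p x _ xNh'; first by split.
  move=> u; apply/idP/eqP => [ux|-> //].
  by apply: (embedding_unique_neighbor aG _ xNh' ux px); split.
by exists t', h'; split; rewrite ?h'_root // ot' ot.
Qed.

(** * Isomorphic terms *)

Definition req (s t : rtree) := riso (realize s) (realize t).
Definition ueq (s t : rtree) := iso (realize s) (realize t).

Lemma req_ueq s t : req s t -> ueq s t.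
Proof. exact: riso_iso. Qed.

Lemma req_graft R R' A A' : req R R' -> req A A' -> req (Graft R A) (Graft R' A').
Proof. exact: graft_riso. Qed.

Lemma req_swap R A B : req (Graft (Graft R A) B) (Graft (Graft R B) A).
Proof. exact: graft_swap. Qed.

Lemma ueq_flip R A : ueq (Graft R A) (Graft A R).
Proof. exact: graft_flip. Qed.

(** This moves the root along one edge. *)
Lemma ueq_reroot L M B : ueq (Graft L (Graft M B)) (Graft (Graft M L) B).
Proof. exact: iso_trans (ueq_flip _ _) (req_ueq (req_swap _ _ _)). Qed.

Lemma ueq_nverts s t : ueq s t -> nverts s = nverts t.
Proof. by move/iso_card; rewrite !realize_nverts. Qed.

Lemma ueq_leaves s t : ueq s t -> leaves s = leaves t.
Proof. by move/iso_num_leaves; rewrite !realize_leaves. Qed.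

Lemma ueq_nsub s t : ueq s t -> nsub s = nsub t.
Proof. by move/iso_num_subtrees; rewrite !realize_nsub. Qed.

Lemma req_rdeg s t : req s t -> rdeg s = rdeg t.
Proof. by move/riso_degree; rewrite !realize_rdeg. Qed.

Lemma rsub_gt0 t : 0 < rsub t.
Proof. by elim: t => //= R IHR A _; rewrite muln_gt0 IHR. Qed.

Lemma nsub_le t : nsub t <= 2 ^ nverts t.
Proof.
rewrite -realize_nsub -realize_nverts -cardsT -card_powerset; apply/subset_leq_card/subsetP => S _.
by rewrite inE subsetT.
Qed.

Fixpoint kids (t : rtree) : seq rtree :=
  if t is Graft R A then A :: kids R else [::].

(** Branches commute, so any branch can be grafted last. *)
Lemma extract_kid (p : pred rtree) t :
  ~~ all p (kids t) -> exists U X, ~~ p X /\ req t (Graft U X).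
Proof.
elim: t => //= R IHR A _; have [pA /= /IHR[U [X [pX tE]]] | pA _] := boolP (p A); last first.
  by exists R, A; split=> //; apply: riso_refl.
exists (Graft U A), X; split=> //; apply: riso_trans (req_swap _ _ _).
exact: req_graft tE (riso_refl _).
Qed.

(** * Spiders *)

Definition chain m := iter m (Graft Dot) Dot.

Fixpoint is_chain (t : rtree) : bool :=
  if t is Graft R A then (rdeg R == 0) && is_chain A else true.

Lemma rdeg0 t : rdeg t = 0 -> t = Dot.
Proof. by case: t. Qed.

Lemma is_chainP t : is_chain t -> exists m, t = chain m.
Proof.
elim: t => [|R _ A IHA] /=; first by exists 0.
by case/andP=> /eqP/rdeg0-> /IHA[m ->]; exists m.+1.
Qed.

(** A leg with [m] edges is a chain grafted by its end. A leg of length zero adds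
nothing, so that the counting formulas hold for all lists of lengths. *)
Definition hang (t : rtree) m := if m is m'.+1 then Graft t (chain m') else t.

Definition spider (l : seq nat) := foldr (fun m t => hang t m) Dot l.

Lemma chain_kids_spider t :
  all is_chain (kids t) -> exists2 l, all (leq 1) l & t = spider l.
Proof.
elim: t => [|R IHR A _] /=; first by exists [::].
case/andP=> /is_chainP[m ->] /IHR[l l0 ->].
by exists (m.+1 :: l).
Qed.

Lemma nverts_chain m : nverts (chain m) = m.+1.
Proof. by elim: m => //= m ->. Qed.

Lemma rsub_chain m : rsub (chain m) = m.+1.
Proof. by elim: m => //= m ->; rewrite mul1n. Qed.

Lemma nsub_chain m : nsub (chain m) = 'C(m.+2, 2).
Proof. by elim: m => //= m ->; rewrite rsub_chain [RHS]binS bin1; lia. Qed.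

Lemma rdeg_chain m : rdeg (chain m) = (0 < m).
Proof. by case: m. Qed.

Lemma outer_leaves_chain m : outer_leaves (chain m) = (0 < m).
Proof. by elim: m => //= m ->; rewrite rdeg_chain; case: m. Qed.

Lemma nverts_spider l : nverts (spider l) = (sumn l).+1.
Proof. by elim: l => //= -[|m] l /= IHl; rewrite ?IHl ?nverts_chain; lia. Qed.

Lemma rsub_spider l : rsub (spider l) = \prod_(m <- l) m.+1.
Proof.
elim: l => [|[|m] l IHl]; rewrite ?big_nil ?big_cons //= -IHl ?mul1n //.
by rewrite rsub_chain mulnC.
Qed.

Lemma nsub_spider l :
  nsub (spider l) = \prod_(m <- l) m.+1 + \sum_(m <- l) 'C(m.+1, 2).
Proof.
elim: l => [|[|m] l IHl]; rewrite ?big_nil ?big_cons //= ?mul1n //.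
rewrite IHl nsub_chain rsub_chain rsub_spider; nia.
Qed.

Lemma rdeg_spider l : all (leq 1) l -> rdeg (spider l) = size l.
Proof. by elim: l => //= -[|m] l //= IHl /IHl->. Qed.

Lemma outer_leaves_spider l : all (leq 1) l -> outer_leaves (spider l) = size l.
Proof.
elim: l => //= -[|m] l //= IHl /IHl->.
by rewrite outer_leaves_chain rdeg_chain; case: m => [|m]; rewrite addn1 ?addn0.
Qed.

Lemma leaves_spider l : 1 < size l -> all (leq 1) l -> leaves (spider l) = size l.
Proof.
move=> l2 l0; rewrite /leaves outer_leaves_spider // rdeg_spider //; lia.
Qed.

Lemma req_hang s t m : req s t -> req (hang s m) (hang t m).
Proof. by case: m => //= m st; apply: req_graft st (riso_refl _). Qed.

Lemma req_hang_swap t m m' : req (hang (hang t m) m') (hang (hang t m') m).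
Proof. case: m m' => [|m] [|m'] /=; try exact: riso_refl; exact: req_swap. Qed.

Lemma spider_perm l l' : perm_eq l l' -> req (spider l) (spider l').
Proof.
elim: l l' => [|m l IHl] l'; first by move/perm_size/esym/size0nil->; apply: riso_refl.
move=> ll'; have ml' : m \in l' by rewrite -(perm_mem ll') mem_head.
case/splitPr: ml' ll' => l1 l2; rewrite perm_sym -cat1s perm_catCA cat1s perm_cons perm_sym.
move/IHl => /(req_hang m) /riso_trans; apply.
elim: l1 {IHl} => [|m1 l1 IH1] /=; first exact: riso_refl.
exact: riso_trans (req_hang_swap _ _ _) (req_hang _ IH1).
Qed.

Lemma ueq_two_chains x y : ueq (Graft (chain y) (chain x)) (chain (x + y).+1).
Proof.
elim: x y => [|x IHx] y; first exact: ueq_flip.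
by apply: iso_trans (ueq_reroot _ _ _) _; rewrite addSnnS; apply: IHx y.+1.
Qed.

Lemma ueq_spider2 x y : 0 < x -> 0 < y -> ueq (spider [:: x; y]) (chain (x + y)).
Proof. case: x y => [|x] [|y] // _ _; rewrite addSn; exact: ueq_two_chains x y.+1. Qed.

(** * Maximum: moving branches together *)

Definition same_class (s t : rtree) := nverts s = nverts t /\ leaves s = leaves t.

(** Walking down from the base [L] to the first branching vertex of [R], the
base only gets heavier and the branch lighter. Moving a branch [B] of that
vertex one edge up then changes the number of subtrees by
[(rsub L - rsub R') * rsub B], which is positive. The hypothesis on [rdeg L]
keeps the upper end of that edge from having been a leaf. *)
Lemma move_up L R :
  0 < rdeg L -> rsub R <= rsub L -> ~~ is_chain R ->
  exists2 t, same_class (Graft L R) t & nsub (Graft L R) < nsub t.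
Proof.
elim: R L => //= R' _ B IHB L dL fRL; rewrite negb_and.
have fB := rsub_gt0 B; have fR' := rsub_gt0 R'.
have [/rdeg0 R'E /= BNch | dR' _] := eqVneq (rdeg R') 0.
  have [|t [n_t l_t] F_t] := IHB (Graft Dot L) isT _ BNch.
  - by move: fRL; rewrite R'E /=; lia.
  exists t; last by move: F_t; rewrite R'E /=; nia.
  by move: n_t l_t; rewrite R'E /same_class /leaves /=; lia.
exists (Graft (Graft L B) R'); first by rewrite /same_class /leaves /=; lia.
have lt_f : rsub R' < rsub L by nia.
have : rsub R' * rsub B < rsub L * rsub B by rewrite ltn_pmul2r.
by rewrite /=; nia.
Qed.

(** Rerooted at a branching vertex, a tree that is not a spider has a branch [X]
with another branching vertex. If [X] is lighter than the rest [U], the latter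
is a base for [move_up]; otherwise a branch of [U] gains from being moved down
to the root of [X]. *)
Lemma branching_improves t :
  2 < rdeg t -> ~~ all is_chain (kids t) ->
  exists2 t', same_class t t' & nsub t < nsub t'.
Proof.
move=> dt /extract_kid[U [X [XNch tE]]].
have dU : 1 < rdeg U by move: dt; rewrite (req_rdeg tE).
suff [t' [n_t' l_t'] F_t'] : exists2 t', same_class (Graft U X) t' & nsub (Graft U X) < nsub t'.
  exists t'; last by rewrite (ueq_nsub (req_ueq tE)).
  by rewrite /same_class (ueq_nverts (req_ueq tE)) (ueq_leaves (req_ueq tE)).
have [le_f|lt_f] := leqP (rsub X) (rsub U); first by apply: move_up; lia.
have dX : 0 < rdeg X by case: (X) XNch.
case: U dU lt_f {tE} => //= U' A dU' lt_f.
have fA := rsub_gt0 A; have fU' := rsub_gt0 U'.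
exists (Graft U' (Graft X A)); first by rewrite /same_class /leaves /=; lia.
have lt_f' : rsub U' < rsub X by nia.
have : rsub U' * rsub A < rsub X * rsub A by rewrite ltn_pmul2r.
by rewrite /=; nia.
Qed.

(** The new root is the first vertex of [X] with two branches, found by moving
the root down along the edges. *)
Lemma exists_branching L X : ~~ is_chain X -> exists2 t, ueq (Graft L X) t & 2 < rdeg t.
Proof.
elim: X L => //= X' _ B IHB L; rewrite negb_and.
have [/rdeg0-> /= /IHB BNch | dX' _] := eqVneq (rdeg X') 0.
  have [t tE dt] := BNch (Graft Dot L).
  by exists t => //; apply: iso_trans tE; apply: ueq_reroot.
by exists (Graft (Graft X' B) L); [apply: ueq_flip | rewrite /= !ltnS lt0n].
Qed.

Lemma spider_or_improves t :
  1 < leaves t -> 2 < nverts t ->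
  (exists l, [/\ ueq t (spider l), all (leq 1) l & size l = leaves t]) \/
  (exists2 t', same_class t t' & nsub t < nsub t').
Proof.
move=> l_t n_t.
have spiderP s : ueq t s -> all is_chain (kids s) ->
    exists l, [/\ ueq t (spider l), all (leq 1) l & size l = leaves t].
  move=> ts /chain_kids_spider[l l0 sE]; rewrite {}sE {s} in ts.
  have [l2|l2] := ltnP 1 (size l).
    by exists l; split=> //; rewrite (ueq_leaves ts) leaves_spider.
  (* A path rooted at its end has a single leg: reroot it one edge further. *)
  case: l l0 l2 ts => [|[|[|m]] [|]] // _ _ ts; try by move: n_t; rewrite (ueq_nverts ts).
  exists [:: m.+1; 1]; split=> //.
    by apply: iso_trans ts _; apply: iso_sym; rewrite -[m.+2]addn1; apply: ueq_spider2.
  by rewrite (ueq_leaves ts) /leaves /= outer_leaves_chain rdeg_chain; case: (m).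
have [t_ch|] := boolP (all is_chain (kids t)); first by left; apply: spiderP (iso_refl _) t_ch.
move=> /extract_kid[U [X [XNch tE]]].
have [s sE ds] := exists_branching U XNch.
have ts : ueq t s := iso_trans (req_ueq tE) sE.
have [s_ch|s_ch] := boolP (all is_chain (kids s)); first by left; apply: spiderP s_ch.
have [t' [n_t' l_t'] F_t'] := branching_improves ds s_ch.
right; exists t'; last by rewrite (ueq_nsub ts).
by rewrite /same_class (ueq_nverts ts) (ueq_leaves ts).
Qed.

Definition balanced (l : seq nat) := all (fun x => all (fun y => x <= y.+1) l) l.

Lemma balancedP l : reflect {in l &, forall x y, x <= y.+1} (balanced l).
Proof.
apply: (iffP allP) => bal_l x; first by move=> y xl yl; move/allP: (bal_l x xl); apply.
by move=> xl; apply/allP => y; apply: bal_l.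
Qed.

(** The list of leg lengths of the balanced spider with [s] edges and [k] legs. *)
Definition balanced_parts s k := nseq (k - s %% k) (s %/ k) ++ nseq (s %% k) (s %/ k).+1.

Lemma size_balanced_parts s k : 0 < k -> size (balanced_parts s k) = k.
Proof. by move=> k0; rewrite size_cat !size_nseq subnK // ltnW // ltn_pmod. Qed.

Lemma sumn_balanced_parts s k : 0 < k -> sumn (balanced_parts s k) = s.
Proof.
move=> k0; rewrite sumn_cat !sumn_nseq [RHS](divn_eq s k).
have := ltn_pmod s k0; nia.
Qed.

Lemma balanced_parts_balanced s k : balanced (balanced_parts s k).
Proof. by apply/balancedP => x y; rewrite !mem_cat !mem_nseq; lia. Qed.

Lemma balanced_parts_pos s k : 0 < k <= s -> all (leq 1) (balanced_parts s k).
Proof.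
case/andP=> k0 ks; have q0 : 0 < s %/ k by rewrite divn_gt0.
by rewrite all_cat !all_nseq q0 !orbT.
Qed.

(** The entries of a balanced list take at most two consecutive values; the
division of the sum by the length recovers the smaller one and the
multiplicity of the larger one. *)
Lemma balanced_perm l : balanced l -> l != [::] -> perm_eq l (balanced_parts (sumn l) (size l)).
Proof.
move=> /balancedP bal_l l0.
have [m ml min_m] : exists2 m, m \in l & forall x, x \in l -> m <= x.
  case: l l0 {bal_l} => // x l _; elim: l x => [|y l IHl] x.
    by exists x; rewrite ?mem_head // => z; rewrite inE => /eqP->.
  have [m ml min_m] := IHl (minn x y); exists m.
    move: ml; rewrite !inE => /orP[/eqP->|->]; last by rewrite !orbT.
    by rewrite /minn; case: ifP; rewrite eqxx ?orbT.
  have mxy := min_m _ (mem_head _ _).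
  move=> z; rewrite !inE => /or3P[/eqP->|/eqP->|zl]; try by lia.
  by apply: min_m; rewrite inE zl orbT.
have vals x : x \in l -> (x == m) || (x == m.+1).
  by move=> xl; have := bal_l x m xl ml; have := min_m x xl; lia.
pose j := count_mem m.+1 l.
have permE s : {in s, forall x, (x == m) || (x == m.+1)} ->
    perm_eq s (nseq (count_mem m s) m ++ nseq (count_mem m.+1 s) m.+1).
  elim: s => // x s IHs sP.
  have /IHs{}IHs : {in s, forall x, (x == m) || (x == m.+1)}.
    by move=> y ys; apply: sP; rewrite inE ys orbT.
  case/orP: (sP x (mem_head _ _)) => /eqP->; rewrite /= eqxx.
    by rewrite ltn_eqF // add1n add0n /= perm_cons.
  rewrite gtn_eqF // add1n add0n /= -[m.+1 :: nseq _ _]cat1s.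
  by rewrite perm_sym perm_catCA perm_sym perm_cons.
have := permE l vals; rewrite -/j => lE.
have sizeE : size l = count_mem m l + j by rewrite (perm_size lE) size_cat !size_nseq.
have sumE : sumn l = size l * m + j.
  by rewrite (perm_sumn lE) sumn_cat !sumn_nseq sizeE; lia.
have m_gt0 : 0 < count_mem m l by rewrite -has_count has_pred1.
rewrite /balanced_parts sumE.
have -> : (size l * m + j) %% size l = j by rewrite mulnC modnMDl modn_small // sizeE; lia.
have -> : (size l * m + j) %/ size l = m.
  by rewrite mulnC divnMDl ?divn_small ?addn0 // sizeE; lia.
by rewrite sizeE addnK.
Qed.

(** Moving a vertex from a leg of length [x] to one of length [y], with
[y + 2 <= x], gains [x - y - 1] times the product of the [m + 1] over the other
leg lengths [m] among the subtrees through the center, and loses [x - y - 1]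
among the paths inside the legs; with a third leg, that product is at least
two. *)
Lemma unbalanced_improves l :
  2 < size l -> all (leq 1) l -> ~~ balanced l ->
  exists2 l', [/\ size l' = size l, sumn l' = sumn l & all (leq 1) l'] &
    nsub (spider l) < nsub (spider l').
Proof.
move=> l3 l0 /allPn[x xl /allPn[y yl]]; rewrite -ltnNge => xy.
have yl' : y \in rem x l.
  by have := yl; rewrite (perm_mem (perm_to_rem xl)) inE ltn_eqF //; lia.
have lE : perm_eq l (x :: y :: rem y (rem x l)).
  by rewrite (perm_trans (perm_to_rem xl)) // perm_cons perm_to_rem.
move: (rem y _) lE => {yl'} s lE; case: x => // x in xl xy lE *.
exists (x :: y.+1 :: s).
  rewrite (perm_size lE) (perm_sumn lE) /=; split=> //; first by lia.
  by move: l0; rewrite (perm_all _ lE) /= => /andP[_ ->]; lia.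
rewrite !nsub_spider !(perm_big _ lE) !big_cons /=.
have P2 : 1 < \prod_(m <- s) m.+1.
  have s0 := perm_size lE; move: l0; rewrite (perm_all _ lE) /= => /andP[_].
  case: s {lE} s0 => [s0|m s _ /andP[m0 _]]; first by rewrite s0 in l3.
  by rewrite big_cons; apply: (@leq_mul 2 1) => //; apply: prodn_gt0.
rewrite !(binS _ 1) !bin1; set P := \prod_(m <- s) _ in P2 *.
by nia.
Qed.

Definition max_tree n k := spider (balanced_parts n.-1 k).

(** Improvements end because there are at most [2 ^ nverts t] subtrees. With two
leaves nothing can be improved by balancing, but then every tree is a path. *)
Lemma max_tree_max t :
  1 < leaves t -> 2 < nverts t ->
  nsub t <= nsub (max_tree (nverts t) (leaves t)) /\
  (nsub t = nsub (max_tree (nverts t) (leaves t)) -> ueq t (max_tree (nverts t) (leaves t))).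
Proof.
have [d] := ubnP (2 ^ nverts t - nsub t); elim: d t => // d IHd t lt_d l_t n_t.
have improve s : same_class t s -> nsub t < nsub s ->
    nsub t <= nsub (max_tree (nverts t) (leaves t)) /\
    (nsub t = nsub (max_tree (nverts t) (leaves t)) -> ueq t (max_tree (nverts t) (leaves t))).
  move=> [n_s l_s] lt_F; have [|||le_F _] := IHd s; rewrite -?n_s -?l_s //.
    by have := nsub_le s; rewrite -n_s; lia.
  have lt_F' : nsub t < nsub (max_tree (nverts t) (leaves t)).
    by apply: leq_trans lt_F _; rewrite n_s l_s.
  by split=> [|F_t]; [exact: ltnW | rewrite F_t ltnn in lt_F'].
case: (spider_or_improves l_t n_t) => [[l [tE l0 sz_l]] | [s ts]]; last exact: improve.
have n_l := ueq_nverts tE; rewrite nverts_spider in n_l.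
have [bal_l|bal_l] := boolP (balanced l).
  have tE' : ueq t (max_tree (nverts t) (leaves t)).
    apply: iso_trans tE (req_ueq (spider_perm _)).
    by rewrite n_l -sz_l; apply: balanced_perm => //; rewrite -size_eq0 -lt0n sz_l ltnW.
  by rewrite -(ueq_nsub tE').
have [l3|l3] := ltnP 2 (size l).
  have [l' [sz_l' n_l' l0'] lt_F] := unbalanced_improves l3 l0 bal_l.
  rewrite -(ueq_nsub tE) in lt_F; apply: improve lt_F; split.
    by rewrite nverts_spider n_l n_l'.
  by rewrite leaves_spider ?sz_l' //; lia.
suff tE' : ueq t (max_tree (nverts t) (leaves t)) by rewrite -(ueq_nsub tE').
have chainE s : size s = 2 -> all (leq 1) s -> sumn s = sumn l -> ueq (spider s) (chain (sumn l)).
  case: s => [|x [|y []]] //= _ /and3P[x0 y0 _] <-.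
  by rewrite addn0; apply: ueq_spider2.
apply: iso_trans tE (iso_trans (chainE l _ l0 erefl) (iso_sym (chainE _ _ _ _))); first by lia.
- by rewrite size_balanced_parts; lia.
- by apply: balanced_parts_pos; lia.
- by rewrite sumn_balanced_parts ?n_l //; lia.
Qed.

(** * Minimum: moving branches apart *)

Definition pendant t := Graft t Dot.

Definition star b := iter b pendant Dot.

Definition broom j b := iter j (Graft Dot) (star b).

Definition dbroom j a b := iter a pendant (broom j b).

Lemma star_kids t : all (fun s => rdeg s == 0) (kids t) -> t = star (rdeg t).
Proof. by elim: t => //= R IHR A _ /andP[/eqP/rdeg0-> /IHR {1}->]. Qed.

(** Moving [A] from the root to the root of [B] changes the number of subtrees
by [rsub A * (rsub B - rsub Z * (rsub L).+1)], and moving it to the root of [L]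
by the same expression with [B] and [L] exchanged. Both cannot be nonnegative,
as this would give [rsub B > rsub L > rsub B]. Since [B] and [L] have branches,
no leaf is lost. *)
Lemma move_away Z A B L :
  0 < rdeg B -> 0 < rdeg L ->
  exists2 t, same_class (Graft (Graft (Graft Z A) B) L) t &
    nsub t < nsub (Graft (Graft (Graft Z A) B) L).
Proof.
move=> dB dL; have z0 := rsub_gt0 Z; have a0 := rsub_gt0 A.
have [lt_b|le_b] := ltnP (rsub B) (rsub Z * (rsub L).+1).
  exists (Graft (Graft Z (Graft B A)) L); first by rewrite /same_class /leaves /=; lia.
  have : rsub A * rsub B < rsub A * (rsub Z * (rsub L).+1) by rewrite ltn_pmul2l.
  by rewrite /=; nia.
exists (Graft (Graft Z B) (Graft L A)); first by rewrite /same_class /leaves /=; lia.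
have lt_l : rsub L < rsub Z * (rsub B).+1 by nia.
have : rsub A * rsub L < rsub A * (rsub Z * (rsub B).+1) by rewrite ltn_pmul2l.
by rewrite /=; nia.
Qed.

(** The root of [X] has a neighbor that is not a leaf, the root of [L]. If it
has a second one and a third neighbor, [move_away] applies. Otherwise its
branches are all single leaves, or it has a single branch, and the argument
continues there. *)
Lemma broom_or_improves L X :
  0 < rdeg L ->
  (exists j b, X = broom j b) \/
  (exists2 t, same_class (Graft L X) t & nsub t < nsub (Graft L X)).
Proof.
elim: X L => [|X' _ B IHB] L dL; first by left; exists 0, 0.
have [/rdeg0-> | dX'] := eqVneq (rdeg X') 0.
  have [[j [b ->]]|[t [n_t l_t] F_t]] := IHB (Graft Dot L) isT.
    by left; exists j.+1, b.
  have E := ueq_reroot L Dot B.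
  right; exists t; last by rewrite (ueq_nsub E).
  by rewrite /same_class (ueq_nverts E) (ueq_leaves E).
have [|] := boolP (all (fun s => rdeg s == 0) (kids (Graft X' B))).
  by move/star_kids->; left; exists 0, (rdeg (Graft X' B)).
case/extract_kid=> X1 [C [dC XE]]; right.
have := req_rdeg XE; case: X1 XE => [|Z A] XE; first by case=> dE; rewrite dE in dX'.
move=> _.
have E : ueq (Graft L (Graft X' B)) (Graft (Graft (Graft Z A) C) L).
  by apply: iso_trans (ueq_flip _ _) (req_ueq (req_graft XE (riso_refl _))).
have [|t [n_t l_t] F_t] := @move_away Z A C L _ dL; first by rewrite lt0n.
exists t; last by rewrite (ueq_nsub E).
by rewrite /same_class (ueq_nverts E) (ueq_leaves E).
Qed.

(** A bare path is also a path with one leaf at its end. *)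
Lemma broom_normal j b : 0 < rdeg (broom j b) -> exists j' b', 0 < b' /\ broom j b = broom j' b'.
Proof.
case: b => [|b] db; last by exists j, b.+1.
case: j db => // j _; exists j, 1; split=> //.
by rewrite /broom iterSr.
Qed.

(** Two brooms joined at their handles form one path, along which the root can
be moved to the first star. *)
Lemma ueq_brooms i a j b :
  ueq (Graft (broom i a) (broom j b)) (Graft (star a) (broom (i + j) b)).
Proof.
elim: i j => [|i IHi] j; first exact: iso_refl.
apply: iso_trans (ueq_flip _ _) (iso_trans (ueq_reroot _ _ _) _).
by apply: iso_trans (ueq_flip _ _) _; rewrite addSnnS; apply: IHi j.+1.
Qed.

Lemma req_dbroom j a b : req (Graft (star a) (broom j b)) (dbroom j.+1 a b).
Proof.
elim: a => [|a IHa]; first exact: riso_refl.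
by apply: riso_trans (req_swap _ _ _) (req_graft IHa (riso_refl _)).
Qed.

Lemma dbroom_sym j a b : ueq (dbroom j a b) (dbroom j b a).
Proof.
case: j => [|j]; first by rewrite /dbroom /broom /star /= -!iterD addnC; apply: iso_refl.
apply: iso_trans (iso_sym (req_ueq (req_dbroom _ _ _))) _.
apply: iso_trans (req_ueq (req_dbroom _ _ _)).
have := ueq_brooms j a 0 b; rewrite addn0 => E.
exact: iso_trans (iso_sym E) (ueq_flip _ _).
Qed.

Lemma nverts_dbroom j a b : nverts (dbroom j a b) = (j + (a + b)).+1.
Proof.
have starE : nverts (star b) = b.+1 by elim: b => //= b ->; rewrite addn1.
have broomE : nverts (broom j b) = (j + b).+1 by elim: j => //= j ->.
by elim: a => //= a ->; rewrite addn1 !addnS.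
Qed.

Lemma leaves_dbroom j a b : 0 < a -> 0 < b -> leaves (dbroom j a b) = a + b.
Proof.
move=> a0 b0.
have d_star : rdeg (star b) = b by elim: b {b0} => //= b ->.
have l_star : outer_leaves (star b) = b by elim: b {b0 d_star} => //= b ->; rewrite addn0 addn1.
have d_broom i : 0 < rdeg (broom i b) by case: i => //; rewrite d_star.
have l_broom : outer_leaves (broom j b) = b.
  by elim: j => //= j ->; rewrite eqn0Ngt d_broom add0n addn0.
have d_dbroom c : rdeg (dbroom j c b) = c + rdeg (broom j b) by elim: c => //= c ->.
have l_dbroom c : outer_leaves (dbroom j c b) = c + b by elim: c => //= c ->; lia.
by have := d_broom j; rewrite /leaves d_dbroom l_dbroom; lia.
Qed.

Lemma nsub_dbroom j a b :
  nsub (dbroom j a b) = (2 ^ a + 2 ^ b) * j + 2 ^ (a + b) + (a + b) + 'C(j, 2).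
Proof.
have f_star : rsub (star b) = 2 ^ b by elim: b => //= b ->; rewrite expnS mulnC.
have F_star : nsub (star b) = 2 ^ b + b.
  elim: b f_star => //= b IHb; rewrite expnS => f_star.
  have {}f_star : rsub (star b) = 2 ^ b by lia.
  by rewrite IHb // f_star; lia.
have f_broom i : rsub (broom i b) = i + 2 ^ b by elim: i => //= i ->; lia.
have F_broom : nsub (broom j b) = 2 ^ b + b + j + j * 2 ^ b + 'C(j, 2).
  elim: j => [|j IHj]; first by rewrite /broom /= F_star bin_small; lia.
  by rewrite /broom iterS -/(broom j b) /= IHj f_broom binS bin1 mul1n mulSn; lia.
have f_dbroom c : rsub (dbroom j c b) = 2 ^ c * (j + 2 ^ b).
  by elim: c => [|c IHc] /=; rewrite ?f_broom ?mul1n // IHc expnS; lia.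
elim: a => [|a IHa]; first by rewrite /dbroom /= F_broom add0n; lia.
by rewrite /dbroom iterS -/(dbroom j a b) /= IHa f_dbroom addSn !expnS expnD; nia.
Qed.

(** At a root with two neighbors that are not leaves, [broom_or_improves]
applies to the tree cut at one of the edges to them, from both sides. *)
Lemma dbroom_or_improves t :
  2 < nverts t ->
  (exists j a b, [/\ 0 < a, 0 < b & ueq t (dbroom j a b)]) \/
  (exists2 s, same_class t s & nsub s < nsub t).
Proof.
move=> n_t; have [s ts ds] : exists2 s, ueq t s & 1 < rdeg s.
  case: t n_t => // R A n_t; have [dR|dR] := ltnP 0 (rdeg R).
    by exists (Graft R A); first exact: iso_refl.
  exists (Graft A R); first exact: ueq_flip.
  have R0 : R = Dot by apply: rdeg0; lia.
  by case: A n_t => //; rewrite R0.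
have [|] := boolP (all (fun s => rdeg s == 0) (kids s)).
  move/star_kids=> sE; left; case: (rdeg s) sE ds => [|[|d]] // sE _.
  by exists 0, 1, d.+1; split=> //; rewrite sE in ts.
case/extract_kid=> L [X [dX sE]]; rewrite -lt0n in dX.
have dL : 0 < rdeg L by move: ds; rewrite (req_rdeg sE).
have E := iso_trans ts (req_ueq sE).
have [[j [b XE]] | [t' [n_t' l_t'] F_t']] := broom_or_improves X dL; last first.
  right; exists t'; last by rewrite (ueq_nsub E).
  by rewrite /same_class (ueq_nverts E) (ueq_leaves E).
have E' := iso_trans E (ueq_flip _ _).
have [[i [a LE]] | [t' [n_t' l_t'] F_t']] := broom_or_improves L dX; last first.
  right; exists t'; last by rewrite (ueq_nsub E').
  by rewrite /same_class (ueq_nverts E') (ueq_leaves E').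
rewrite {}XE in dX E E'; rewrite {}LE in dL E E'.
have [i' [a' [a0 LE]]] := broom_normal dL; have [j' [b' [b0 XE]]] := broom_normal dX.
left; exists (i' + j').+1, a', b'; split=> //.
apply: iso_trans E _; rewrite LE XE.
exact: iso_trans (ueq_brooms _ _ _ _) (req_ueq (req_dbroom _ _ _)).
Qed.

Lemma halves k : k %/ 2 + ceil_divn k 2 = k /\ k %/ 2 <= ceil_divn k 2 <= (k %/ 2).+1.
Proof. by rewrite /ceil_divn; lia. Qed.

(** If [a + 2 <= b], both balanced exponents are at most [b - 1], so that the
balanced sum is at most [2 ^ b]. *)
Lemma balanced_powers a b :
  2 ^ ((a + b) %/ 2) + 2 ^ (ceil_divn (a + b) 2) <= 2 ^ a + 2 ^ b ?= iff
    (((a + b) %/ 2, ceil_divn (a + b) 2) \in [:: (a, b); (b, a)]).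
Proof.
wlog le_ab : a b / a <= b => [th|].
  have [/th//|/ltnW/th] := leqP a b.
  by rewrite [b + a]addnC [2 ^ b + _]addnC !inE orbC.
have [k_sum /andP[le1 le2]] := halves (a + b).
have [eq_ab|lt_ab] := leqP b a.+1.
  have -> : (a + b) %/ 2 = a by lia.
  have -> : ceil_divn (a + b) 2 = b by move: k_sum; rewrite (_ : (a + b) %/ 2 = a); lia.
  by rewrite mem_head; apply/leqif_refl.
rewrite (_ : _ \in _ = false); last first.
  by apply/negbTE; rewrite !inE !xpair_eqE; lia.
apply/leqifP; rewrite /=.
have le_b c : c <= b.-1 -> 2 ^ c <= 2 ^ b.-1 by rewrite leq_exp2l.
have bE : 2 ^ b = 2 * 2 ^ b.-1 by rewrite -expnS prednK //; lia.
have := le_b ((a + b) %/ 2); have := le_b (ceil_divn (a + b) 2).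
have : 0 < 2 ^ a by rewrite expn_gt0.
by lia.
Qed.

Definition min_tree n k := dbroom (n - k).-1 (k %/ 2) (ceil_divn k 2).

Lemma min_tree_min t :
  2 < nverts t ->
  nsub (min_tree (nverts t) (leaves t)) <= nsub t /\
  (nsub t = nsub (min_tree (nverts t) (leaves t)) -> ueq t (min_tree (nverts t) (leaves t))).
Proof.
have [d] := ubnP (nsub t); elim: d t => // d IHd t lt_d n_t.
have [[j [a [b [a0 b0 E]]]] | [s [n_s l_s] F_s]] := dbroom_or_improves n_t; last first.
  have [||le_F _] := IHd s; rewrite -?n_s -?l_s //; first by apply: leq_trans F_s _.
  rewrite n_s l_s; split=> [|F_t]; first by apply: leq_trans le_F (ltnW F_s).
  by move: F_s; rewrite F_t ltnNge le_F.
rewrite /min_tree (ueq_nverts E) (ueq_leaves E) (ueq_nsub E).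
rewrite nverts_dbroom leaves_dbroom //.
have -> : ((j + (a + b)).+1 - (a + b)).-1 = j by lia.
have [k_sum _] := halves (a + b).
rewrite !nsub_dbroom k_sum.
have [le_pow eq_pow] := balanced_powers a b; split.
  by rewrite !leq_add2r leq_mul2r le_pow orbT.
(* For [j = 0] the tree is a star, whatever the distribution of the leaves. *)
move/eqP; rewrite !eqn_add2r eqn_mul2r [2 ^ a + _ == _]eq_sym eq_pow => /orP[/eqP j0|].
  apply: iso_trans E _; rewrite j0 /dbroom /broom /star /= -!iterD k_sum; exact: iso_refl.
rewrite !inE !xpair_eqE => /orP[] /andP[/eqP-> /eqP->] //.
exact: iso_trans E (dbroom_sym _ _ _).
Qed.

(** * Legs *)

(** A leg of the graft stays in the base, or enters the branch at once; in the
second case it stops at the root of the branch exactly when that is a leaf. *)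
Fixpoint legs (t : rtree) : seq (seq (realize t)) :=
  if t is Graft R A then
    [seq map inl p | p <- legs R] ++
    [seq inr (rootv (realize A)) :: map inr p |
      p <- if rdeg A == 0 then [:: [::]] else legs A]
  else [::].

Lemma is_leg_embedding (G H : sgraph) (f : G -> H) c p :
  embedding f -> (forall x, x != c -> leaf (f x) = leaf x) ->
  is_leg (f c) (map f p) = is_leg c p.
Proof.
move=> [f_inj f_adj] f_leaf; rewrite /is_leg path_map last_map -map_cons map_inj_uniq //.
rewrite (eq_path (e' := @adj G)) //; case: p => [|x p] //.
have [u|_] := boolP (uniq (c :: x :: p)); last by rewrite !andbF.
rewrite f_leaf //; apply: contraTneq u => lastE.
by rewrite cons_uniq -{1}lastE [last _ _]/= mem_last.
Qed.

Lemma mem_legs t p : (p \in legs t) = is_leg (rootv (realize t)) p.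
Proof.
elim: t p => [|R IHR A IHA] p.
  by case: p => [|[] p] //; rewrite /is_leg /= inE eqxx andbF.
have legl q : is_leg (rootv (realize (Graft R A))) (map inl q) = is_leg (rootv (realize R)) q.
  apply: (@is_leg_embedding (realize R) (realize (Graft R A)) inl) => [|x /negPf xr].
    by split=> // u v [].
  by rewrite /leaf degree_graft_l xr addn0.
have legr q : is_leg (rootv (realize (Graft R A))) (inr (rootv (realize A)) :: map inr q) =
    if q is [::] then rdeg A == 0 else is_leg (rootv (realize A)) q.
  case: q => [|y q].
    by rewrite /is_leg /= !eqxx /leaf degree_graft_r eqxx realize_rdeg addn1.
  rewrite -(@is_leg_embedding (realize A) (realize (Graft R A)) inr) => [||x /negPf xr].
  - have rN : inl (rootv (realize R)) \notin inr (rootv (realize A)) :: map inr (y :: q).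
      by rewrite inE; apply/mapP => -[].
    by rewrite /is_leg [uniq (rootv _ :: _)]cons_uniq rN /= !eqxx.
  - by split=> // u v [].
  - by rewrite /leaf degree_graft_r xr addn0.
rewrite mem_cat; apply/orP/idP => [[/mapP[q qL ->]|/mapP[q qL ->]] | p_leg].
- by rewrite legl -IHR.
- rewrite legr; case: ifP qL => [dA|_]; first by rewrite inE => /eqP->.
  by rewrite IHA; case: (q).
have := p_leg; rewrite /is_leg cons_uniq; case: p p_leg => // u p p_leg /and4P[_ up /andP[rNp _] _].
move: up; rewrite /= => /andP[ru up].
case: (path_graft_side up) => [|[q qE]|[q qE]]; first by rewrite (negPf rNp).
- by left; rewrite qE map_f // IHR -legl -qE.
- right; case: q qE => // y q [uE pE]; rewrite {}uE {}pE in ru p_leg *.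
  case/andP: ru => _ /eqP yE; rewrite {}yE in p_leg *.
  apply: (map_f (fun q => inr (rootv (realize A)) :: map inr q)).
  move: p_leg; rewrite legr; case: q => [->|y' q]; first by rewrite inE.
  rewrite -IHA; case: eqP => // /rdeg0 AE.
  by move: (y' :: q); rewrite AE.
Qed.

Lemma legs_uniq t : uniq (legs t).
Proof.
elim: t => //= R IHR A IHA; rewrite cat_uniq; apply/and3P; split.
- by rewrite map_inj_uniq //; apply: inj_map => u v [].
- apply/hasPn => _ /mapP[q _ ->]; apply/mapP => -[[|x s] _] //.
- rewrite map_inj_uniq; first by case: ifP.
  by move=> u v []; apply: inj_map => ? ? [].
Qed.

Lemma leg_sizes_chain m : map size (legs (chain m)) = if m is 0 then [::] else [:: m].
Proof.
elim: m => //= -[|m] IHm //=; rewrite -map_comp.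
rewrite (eq_map (g := S \o size)) => [|p]; last by rewrite /= size_map.
by rewrite map_comp IHm.
Qed.

Lemma leg_sizes_spider l : all (leq 1) l -> map size (legs (spider l)) = rev l.
Proof.
elim: l => //= -[|m] l //= IHl /IHl{}IHl.
rewrite map_cat -!map_comp rev_cons -IHl -cats1; congr (_ ++ _).
  by apply: eq_map => p; rewrite /= size_map.
rewrite (eq_map (g := S \o size)) => [|p]; last by rewrite /= size_map.
by rewrite map_comp rdeg_chain; case: m => //= m; rewrite (leg_sizes_chain m.+1).
Qed.

(** * Spiders as graphs *)

(** A vertex of a branch has one more neighbor than it has branches, so degree
at most two outside the root means that no branch ramifies. *)
Lemma chain_kidsP t :
  reflect (forall v : realize t, v != rootv _ -> degree v <= 2) (all is_chain (kids t)).
Proof.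
have is_chainE s : is_chain s = (rdeg s <= 1) && all is_chain (kids s).
  elim: s => //= R _ A IHA; rewrite ltnS leqn0.
  by case: eqP => //= /rdeg0->; rewrite andbT.
elim: t => [|R IHR A IHA]; first by apply: (iffP idP) => // _ [].
rewrite /= is_chainE; apply: (iffP idP) => [/andP[/andP[dA /IHA cA] /IHR cR] | deg2].
  case=> v vr; first by have vr' : v != rootv _ := vr; rewrite degree_graft_l (negPf vr') addn0 cR.
  rewrite degree_graft_r; case: eqP => [->|/eqP vr']; last by rewrite addn0 cA.
  by rewrite realize_rdeg addn1.
apply/andP; split; first (apply/andP; split).
- have := deg2 (inr (rootv _)) isT; by rewrite degree_graft_r eqxx realize_rdeg addn1.
- apply/IHA => v vr; have := deg2 (inr v) isT.
  by rewrite degree_graft_r (negPf vr) addn0.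
- apply/IHR => v vr; have := deg2 (inl v) vr.
  by rewrite degree_graft_l (negPf vr) addn0.
Qed.

Lemma spider_is_Tnk l :
  1 < size l -> all (leq 1) l -> balanced l -> is_Tnk (sumn l).+1 (size l) (realize (spider l)).
Proof.
move=> l2 l0 /balancedP bal_l; split; first by rewrite realize_nverts nverts_spider.
exists (rootv _); split; first split.
- exact: realize_tree.
- move=> v dv; apply/eqP; apply: contraTT dv; rewrite -leqNgt; move: v; apply/chain_kidsP.
  elim: l l0 {l2 bal_l} => //= -[|m] l //= IHl /IHl->; rewrite andbT.
  by elim: m.
- have szE := leg_sizes_spider l0.
  exists (legs (spider l)); split.
  + exact: legs_uniq.
  + exact: mem_legs.
  + by rewrite -(size_map size) szE size_rev.
  + by move=> p q pL qL; apply: bal_l; rewrite -mem_rev -szE map_f.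
Qed.

(** Realized from its center, the graph is a spider whose list of leg lengths is
balanced, hence determined up to order by [n] and [k]. *)
Lemma is_Tnk_spider n k G :
  1 < k -> is_Tnk n k G -> iso (realize (max_tree n k)) G.
Proof.
move=> k2 [n_G [c [[treeG deg2] [ls [ls_uniq ls_leg ls_size ls_bal]]]]].
have [t [f [f_bij f_adj f_root]]] := tree_realize c treeG.
have degE := iso_degree f_bij f_adj.
have /chain_kids_spider[l l0 tE] : all is_chain (kids t).
  apply/chain_kidsP => v vr; rewrite leqNgt -degE.
  apply: contra vr => /deg2 fv; apply/eqP; apply: (bij_inj f_bij).
  by rewrite fv f_root.
have legsE : perm_eq (map (map f) (legs t)) ls.
  apply: uniq_perm => //.
    by rewrite map_inj_uniq ?legs_uniq //; apply: inj_map; apply: bij_inj.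
  move=> p; rewrite ls_leg; have [g fK gK] := f_bij.
  rewrite -(mapK gK p) mem_map; last by apply: inj_map; apply: bij_inj.
  rewrite mem_legs -[c]f_root (is_leg_embedding (f := f)) //.
    by split=> //; apply: bij_inj.
  by move=> x _; rewrite /leaf degE.
have szE : perm_eq (rev l) (map size ls).
  have <- : map size (map (map f) (legs t)) = rev l; last exact: perm_map.
  rewrite -(leg_sizes_spider l0) -tE -map_comp.
  by apply: eq_map => p; rewrite /= size_map.
have sz_l : size l = k by rewrite -size_rev (perm_size szE) size_map.
have bal_l : balanced l.
  apply/balancedP => x y; rewrite -![_ \in l]mem_rev !(perm_mem szE).
  by case/mapP=> p pL -> /mapP[q qL ->]; apply: ls_bal.
have sum_l : sumn l = n.-1.
  have f_iso : iso (realize t) G by exists f.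
  by rewrite -n_G -(iso_card f_iso) realize_nverts tE nverts_spider.
apply: (@iso_trans _ (realize t)); last by exists f.
apply: iso_sym; rewrite tE /max_tree -sum_l -sz_l; apply/req_ueq/spider_perm/balanced_perm => //.
by rewrite -size_eq0 sz_l -lt0n ltnW.
Qed.

(** * Double brooms as graphs *)

(** Rooted at the end of the path that carries the first [a] leaves, the graph
can be built like [dbroom]: first the last [b] leaves, then the path, then the
first leaves. *)
Definition rPmab j a b := @Rooted (Pmab j.+1 a b) (inl ord0).

Lemma card_rPmab j a b : #|rPmab j a b| = j.+1 + (a + b).
Proof. by rewrite !card_sum !card_ord. Qed.

Lemma inj_riso (G H : rooted) (f : G -> H) :
  embedding f -> f (rootv G) = rootv H -> #|H| <= #|G| -> riso G H.
Proof. by move=> [f_inj f_adj] f_root leHG; exists f; split=> //; apply: inj_card_bij. Qed.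

Lemma rPmab_dot : riso dot (rPmab 0 0 0).
Proof.
apply: (@inj_riso dot (rPmab 0 0 0) (fun _ => inl ord0)) => //; last by rewrite card_rPmab card_unit.
by split=> [[] []|[] []].
Qed.

Lemma rPmab_pendant j a b : riso (graft (rPmab j a b) dot) (rPmab j a.+1 b).
Proof.
pose f (u : graft (rPmab j a b) dot) : rPmab j a.+1 b :=
  match u with
  | inl (inl i) => inl i
  | inl (inr (inl i)) => inr (inl (lift ord0 i))
  | inl (inr (inr i)) => inr (inr i)
  | inr _ => inr (inl ord0)
  end.
apply: (inj_riso (f := f)) => //; last by rewrite card_graft card_unit !card_rPmab; lia.
split=> [] [[u|[u|u]]|[]] [[v|[v|v]]|[]] //=; try by case=> ->.
- by case=> /addnI/val_inj->.
- by rewrite eqxx andbT.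
- by rewrite eqxx andbT.
Qed.

Lemma rPmab_star b : riso (graft (rPmab 0 0 b) dot) (rPmab 0 0 b.+1).
Proof.
pose f (u : graft (rPmab 0 0 b) dot) : rPmab 0 0 b.+1 :=
  match u with
  | inl (inl i) => inl i
  | inl (inr (inl i)) => inr (inl i)
  | inl (inr (inr i)) => inr (inr (lift ord0 i))
  | inr _ => inr (inr ord0)
  end.
apply: (inj_riso (f := f)) => //; last by rewrite card_graft card_unit !card_rPmab; lia.
split=> [] [[u|[u|u]]|[]] [[v|[v|v]]|[]] //=; try by case=> ->.
- by case=> /addnI/val_inj->.
- by rewrite eqxx andbT.
- by rewrite eqxx andbT.
Qed.

Lemma rPmab_path j b : riso (graft dot (rPmab j 0 b)) (rPmab j.+1 0 b).
Proof.
pose f (u : graft dot (rPmab j 0 b)) : rPmab j.+1 0 b :=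
  match u with
  | inl _ => inl ord0
  | inr (inl i) => inl (lift ord0 i)
  | inr (inr i) => inr i
  end.
apply: (inj_riso (f := f)) => //; last by rewrite card_graft card_unit !card_rPmab; lia.
split=> [] [[]|[u|[[]|u]]] [[]|[v|[[]|v]]] //=; try by case=> ->.
- by case=> /addnI/val_inj->.
- by rewrite /bump leq0n add1n orbF eqSS eq_sym.
- by rewrite /bump leq0n add1n eqSS eq_sym.
Qed.

Lemma dbroom_Pmab j a b : iso (realize (dbroom j a b)) (Pmab j.+1 a b).
Proof.
suff : riso (realize (dbroom j a b)) (rPmab j a b) by apply: riso_iso.
elim: a => [|a IHa]; last first.
  exact: riso_trans (graft_riso IHa (riso_refl dot)) (rPmab_pendant _ _ _).
elim: j => [|j IHj]; last first.
  exact: riso_trans (graft_riso (riso_refl dot) IHj) (rPmab_path _ _).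
elim: b => [|b IHb]; first exact: rPmab_dot.
exact: riso_trans (graft_riso IHb (riso_refl dot)) (rPmab_star _).
Qed.

(** * The extremal trees *)

Lemma tree_class_realize n k T :
  tree_class n k T ->
  exists t, [/\ iso (realize t) T, nverts t = n & leaves t = k].
Proof.
case=> T_tree n_T k_T; have [r _] : exists r : T, true by case: T_tree => /card_gt0P[r _] _ _; exists r.
have [t /riso_iso tT] := tree_realize r T_tree.
exists t; split=> //; first by rewrite -n_T -(iso_card tT) realize_nverts.
by rewrite -k_T -/(num_leaves T) -(iso_num_leaves tT) realize_leaves.
Qed.

Lemma iso_tree_class t T : iso (realize t) T -> tree_class (nverts t) (leaves t) T.
Proof.
move=> tT; split; first exact: iso_is_tree tT (realize_tree t).
  by rewrite -(iso_card tT) realize_nverts.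
by rewrite -/(num_leaves T) -(iso_num_leaves tT) realize_leaves.
Qed.

(** The congruence leaves two choices for [j] when [k] divides [n - 1]; both
give the same value because floor and ceiling agree then. *)
Lemma nsub_max_tree n k i j :
  0 < k -> i + j = k -> n.-1 = j %[mod k] ->
  nsub (max_tree n k) =
    (n.-1 %/ k + 1) ^ i * (ceil_divn n.-1 k + 1) ^ j
    + i * 'C(n.-1 %/ k + 1, 2) + j * 'C(ceil_divn n.-1 k + 1, 2).
Proof.
move=> k0 ijk; rewrite /max_tree; move: n.-1 => s sj; rewrite nsub_spider !big_cat !big_nseq /=.
rewrite !iter_muln_1 !iter_addn_0 !addn1.
have r_lt := ltn_pmod s k0; have sE := divn_eq s k.
have [r0|r0] := posnP (s %% k).
  have -> : ceil_divn s k = s %/ k.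
    apply/eqP; rewrite eqn_leq ceil_divn_leq // {1}sE r0 addn0 leqnn /=.
    by rewrite /ceil_divn leq_div2r ?leq_addr.
  by rewrite r0 subn0 muln1 -expnD ijk muln0 addn0 -addnA -mulnDl ijk [k * _]mulnC.
have -> : ceil_divn s k = (s %/ k).+1.
  apply/eqP; rewrite eqn_leq ceil_divn_leq //; apply/andP; split; first by nia.
  by rewrite ltnNge ceil_divn_leq // -ltnNge; nia.
have jE : j = s %% k.
  rewrite sj modn_small // ltn_neqAle; apply/andP; split; last by lia.
  by apply: contraTneq r0 => jk; rewrite sj jk modnn.
have iE : k - s %% k = i by lia.
by rewrite iE -jE addnA [i * _]mulnC [j * _]mulnC.
Qed.

Theorem theorem1p1 (n k : nat) (hn : 2 <= n) (hk : 2 <= k <= n - 1) :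
  ((exists Tnk : sgraph, is_Tnk n k Tnk) /\
   forall Tnk : sgraph, is_Tnk n k Tnk ->
     [/\ tree_class n k Tnk,
         forall T : sgraph, tree_class n k T ->
           num_subtrees T <= num_subtrees Tnk /\
           (num_subtrees T = num_subtrees Tnk <-> iso T Tnk)
       & forall i j : nat, i + j = k -> n - 1 = j %[mod k] ->
           num_subtrees Tnk =
             ((n - 1) %/ k + 1) ^ i * (ceil_divn (n - 1) k + 1) ^ j
             + i * 'C((n - 1) %/ k + 1, 2)
             + j * 'C(ceil_divn (n - 1) k + 1, 2)])
  /\
  let P := Pmab (n - k) (k %/ 2) (ceil_divn k 2) in
  [/\ tree_class n k P,
      forall T : sgraph, tree_class n k T ->
        num_subtrees P <= num_subtrees T /\
        (num_subtrees T = num_subtrees P <-> iso T P)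
    & num_subtrees P =
        (2 ^ (k %/ 2) + 2 ^ (ceil_divn k 2)) * (n - k - 1)
        + 2 ^ k + k + 'C(n - k - 1, 2)].
Proof.
have [k2 kn] := andP hk; rewrite !subn1 in kn *.
have k0 : 0 < k := ltnW k2.
pose parts := balanced_parts n.-1 k.
have parts_pos : all (leq 1) parts by apply: balanced_parts_pos; rewrite k0.
have parts_size : size parts = k := size_balanced_parts _ k0.
have parts_sum : (sumn parts).+1 = n by rewrite sumn_balanced_parts // prednK // ltnW.
have max_n : nverts (max_tree n k) = n by rewrite nverts_spider.
have max_k : leaves (max_tree n k) = k by rewrite leaves_spider // parts_size.
have [k_sum _] := halves k.
have half_pos : 0 < k %/ 2 by rewrite divn_gt0.
have ceil_pos : 0 < ceil_divn k 2 by have [_ /andP[]] := halves k; lia.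
have min_n : nverts (min_tree n k) = n by rewrite nverts_dbroom k_sum; lia.
have min_k : leaves (min_tree n k) = k by rewrite leaves_dbroom.
split; [split | move=> P].
- exists (realize (max_tree n k)); rewrite -{1}parts_sum -{1}parts_size.
  by apply: spider_is_Tnk; rewrite ?parts_size ?balanced_parts_balanced.
- move=> G /(is_Tnk_spider k2) maxG; split.
  + by have := iso_tree_class maxG; rewrite max_n max_k.
  + move=> T /tree_class_realize[t [tT t_n t_k]].
    rewrite -(iso_num_subtrees tT) -(iso_num_subtrees maxG) !realize_nsub.
    have [||le_F eq_F] := @max_tree_max t; rewrite ?t_n ?t_k //; first by lia.
    rewrite t_n t_k in le_F eq_F; split=> //; split=> [/eq_F tE | TG].
      exact: iso_trans (iso_sym tT) (iso_trans tE maxG).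
    rewrite -!realize_nsub (iso_num_subtrees tT) (iso_num_subtrees maxG).
    exact: iso_num_subtrees TG.
  + move=> i j ij_k nj.
    by rewrite -(iso_num_subtrees maxG) realize_nsub; apply: nsub_max_tree.
have minP : iso (realize (min_tree n k)) P.
  have := dbroom_Pmab (n - k).-1 (k %/ 2) (ceil_divn k 2); rewrite prednK //; lia.
split.
- by have := iso_tree_class minP; rewrite min_n min_k.
- move=> T /tree_class_realize[t [tT t_n t_k]].
  rewrite -(iso_num_subtrees tT) -(iso_num_subtrees minP) !realize_nsub.
  have [|le_F eq_F] := @min_tree_min t; first by rewrite t_n; lia.
  rewrite t_n t_k in le_F eq_F; split=> //; split=> [/eq_F tE | TP].
    exact: iso_trans (iso_sym tT) (iso_trans tE minP).
  rewrite -!realize_nsub (iso_num_subtrees tT) (iso_num_subtrees minP).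
  exact: iso_num_subtrees TP.
- by rewrite -(iso_num_subtrees minP) realize_nsub nsub_dbroom k_sum.
Qed.
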